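(* Let $H$ be a hypergraph with no isolated vertices and let $p\in(0,1)$. Let $V$ be a smallest set of vertices of $H$ such that, for every edge $e$ of $H$, at least $\lceil p|e|\rceil$ vertices of $e$ lie in $V$. Then $b_{L,p}(H)\leq |V|$ and $b_p(H)\leq |V|+1$.
   Context: A hypergraph $H=(V(H),E(H))$ has a finite nonempty vertex set and a finite collection $E(H)$ of subsets of $V(H)$ called edges (parallel edges allowed); a vertex is isolated if it lies in no edge. For a proportion $p\in(0,1)$, the proportion-based propagation rule is: if at the end of a round at least $\lceil p|e|\rceil$ vertices of an edge $e$ are on fire, then in the next round all vertices of $e$ catch fire; burned vertices stay burned. Burning game: let $F_0=\emptyset$ and $F_r$ be the set of burned vertices at the end of round $r$. In each round $r\geq 1$, simultaneously, vertices catch fire by propagation from $F_{r-1}$ (no propagation in round 1), and a player chooses a vertex $u_r\notin F_{r-1}$ (a source) and sets it on fire. A burning sequence is a sequence $(u_1,\ldots,u_k)$ of such sources after which every vertex is on fire at the end of round $k$; $b_p(H)$ is the minimum length of a burning sequence. Lazy game: $S\subseteq V(H)$ is a lazy burning set if, setting all of $S$ on fire at once and then repeatedly applying the propagation rule, every vertex eventually catches fire; $b_{L,p}(H)$ is the minimum size of a lazy burning set. *)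

(* Defs.v *)
From HB Require Import structures.
From mathcomp Require Import all_boot all_order all_algebra.
From mathcomp Require Import boolp reals.

Set Implicit Arguments.
Unset Strict Implicit.
Unset Printing Implicit Defensive.

Import Order.TTheory GRing.Theory Num.Theory.

Local Open Scope ring_scope.

(* Edges form an indexed family, so parallel edges are allowed; the empty set
   is a legal edge. *)
Record hypergraph := Hypergraph {
  vertex : finType;
  edge : finType;
  vset : edge -> {set vertex};
  vertex_gt0 : (0 < #|vertex|)%N
}.

Arguments vset {h} e.

Definition isolated (H : hypergraph) (v : vertex H) : bool :=
  [forall e : edge H, v \notin vset e].

Section Burning.
Variables (R : realType) (p : R) (H : hypergraph).

Implicit Types (e : edge H) (F S V : {set vertex H}) (v : vertex H).

Definition meets_threshold F e : bool :=
  Num.ceil (p * #|vset e|%:R) <= #|vset e :&: F|%:Z.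

Definition propagate F : {set vertex H} :=
  F :|: \bigcup_(e : edge H | meets_threshold F e) vset e.

(* The set burned at the end of round [size s] when the sources are [s], so
   that F_r is [burned (take r s)].  Propagation from F_0 = set0 does nothing
   when 0 < p (lemma [propagate0]), so round 1 only burns the first source. *)
Definition burned (s : seq (vertex H)) : {set vertex H} :=
  foldl (fun F v => v |: propagate F) set0 s.

Lemma propagate0 : 0 < p -> propagate set0 = set0.
Proof.
move=> p0; rewrite /propagate set0U; apply/eqP; rewrite -subset0.
apply/bigcupsP => e; rewrite /meets_threshold setI0 cards0 => he.
rewrite subset0 -cards_eq0; apply: contraLR he; rewrite -lt0n -ltNge => he.
by rewrite ceil_gt0 mulr_gt0 // ltr0n.
Qed.

(* Round r + 1 is indexed by [r : 'I_k]. *)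
Definition burning_sequence k (u : k.-tuple (vertex H)) : bool :=
  [forall r : 'I_k, tnth u r \notin burned (take r u)] && (burned u == setT).

Lemma burning_sequence_exists :
  exists k, [exists u : k.-tuple (vertex H), burning_sequence u].
Proof.
pose legal (s : seq (vertex H)) :=
  forall s1 v s2, s = s1 ++ v :: s2 -> v \notin burned s1.
suff [s sl sT] : exists2 s, legal s & burned s = setT.
  exists (size s); apply/existsP; exists (in_tuple s).
  apply/andP; split; last exact/eqP.
  apply/forallP => r; apply: (sl _ _ (drop r.+1 s)).
  by rewrite (tnth_nth (tnth (in_tuple s) r)) /= -drop_nth ?cat_take_drop.
suff step n : forall s, legal s -> (#|~: burned s| <= n)%N ->
    exists2 s', legal s' & burned s' = setT.
  by apply: (step _ [::]) (leqnn _) => -[].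
elim: n => [|n IHn] s sl hs.
  exists s => //; have /eqP sC : ~: burned s == set0.
    by rewrite -cards_eq0 -leqn0.
  by rewrite -[burned s]setCK sC setC0.
have [s0|[v vs]] := set_0Vmem (~: burned s).
  by exists s => //; rewrite -[burned s]setCK s0 setC0.
apply: (IHn (rcons s v)).
  move=> s1 w s2; case: (lastP s2) => [|s3 z].
    by rewrite cats1 => /rcons_inj[<- <-]; rewrite -in_setC.
  by rewrite -rcons_cons -rcons_cat => /rcons_inj[/sl + _].
rewrite -ltnS; apply: leq_trans hs; apply: proper_card.
rewrite properE; apply/andP; split.
  rewrite setCS /burned foldl_rcons.
  exact: subset_trans (subsetUl _ _) (subsetUr _ _).
apply/subsetPn; exists v => //.
by rewrite inE negbK /burned foldl_rcons setU11.
Qed.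

Definition burning_number : nat := ex_minn burning_sequence_exists.

Definition lazy_burning_set S : Prop := exists n, iter n propagate S = setT.

Lemma lazy_burning_set_exists :
  exists k, [exists S, `[< lazy_burning_set S >] && (#|S| == k)].
Proof.
exists #|[set: vertex H]|; apply/existsP; exists setT.
by rewrite eqxx andbT; apply/asboolP; exists 0%N.
Qed.

Definition lazy_burning_number : nat := ex_minn lazy_burning_set_exists.

End Burning.

(* Main.v *)
Require Import Defs.
From HB Require Import structures.
From mathcomp Require Import all_boot all_order all_algebra.
From mathcomp Require Import boolp reals.

(* Once V is burned, every edge meets its threshold and, no vertex being
   isolated, one round of propagation burns everything.  In the burning game,
   always burn an unburned vertex of V: V is exhausted after at most |V| rounds,
   and if the fire does not cover H by then, one more round with any unburned
   source finishes. *)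

Set Implicit Arguments.
Unset Strict Implicit.
Unset Printing Implicit Defensive.

Import Order.TTheory GRing.Theory Num.Theory.

Local Open Scope ring_scope.

Section Threshold.
Variables (R : realType) (p : R) (H : hypergraph).
Implicit Types (F V : {set vertex H}) (s : seq (vertex H)).

Lemma meets_threshold_sub F V (e : edge H) :
  F \subset V -> meets_threshold p F e -> meets_threshold p V e.
Proof.
move=> FV /le_trans; apply; rewrite lez_nat.
exact/subset_leq_card/setIS.
Qed.

Lemma propagate_setT F :
  (forall v : vertex H, ~~ isolated v) ->
  (forall e : edge H, meets_threshold p F e) -> propagate p F = setT.
Proof.
move=> noiso thF; apply/setP => v; rewrite in_setT in_setU.
have /forallPn[e] := noiso v; rewrite negbK => ve.
by apply/orP; right; apply/bigcupP; exists e.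
Qed.

(** Phrased on plain sequences so that sources can be appended one at a time; the default [x] is
    irrelevant because [r < size s]. *)
Definition legal s : Prop :=
  forall x r, (r < size s)%N -> nth x s r \notin burned p (take r s).

Lemma legal_rcons s v : legal s -> v \notin burned p s -> legal (rcons s v).
Proof.
move=> sl vs x r; rewrite size_rcons ltnS leq_eqVlt => /predU1P[->|rs].
  by rewrite nth_rcons ltnn eqxx -cats1 take_size_cat.
by rewrite nth_rcons rs -cats1 takel_cat ?(ltnW rs)// sl.
Qed.

Lemma burned_rcons s v : burned p (rcons s v) = v |: propagate p (burned p s).
Proof. exact: foldl_rcons. Qed.

Lemma burning_number_le s :
  legal s -> burned p s = setT -> (burning_number p H <= size s)%N.
Proof.
move=> sl sT; rewrite /burning_number; case: ex_minnP => m _; apply.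
apply/existsP; exists (in_tuple s); apply/andP; split; last exact/eqP.
apply/forallP => r; rewrite (tnth_nth (tnth (in_tuple s) r)).
exact/sl/ltn_ord.
Qed.

Lemma lazy_burning_number_le F :
  lazy_burning_set p F -> (lazy_burning_number p H <= #|F|)%N.
Proof.
move=> FT; rewrite /lazy_burning_number; case: ex_minnP => m _; apply.
by apply/existsP; exists F; rewrite eqxx andbT; apply/asboolP.
Qed.

(** Greedy choice: each new source is a vertex of [V] not yet burned, so the unburned part of [V]
    shrinks strictly every round. *)
Lemma legal_cover V :
  exists s, [/\ legal s, (size s <= #|V|)%N & V \subset burned p s].
Proof.
(* [n] is a budget: it bounds both the unburned vertices of [V] and the sources still allowed. *)
suff step n s : legal s -> (#|V :\: burned p s| <= n)%N ->
    (size s + n <= #|V|)%N ->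
    exists s', [/\ legal s', (size s' <= #|V|)%N & V \subset burned p s'].
  by apply: (step #|V| [::]); rewrite ?add0n// subset_leq_card// subsetDl.
elim: n s => [|n IHn] s sl Vn sn.
  exists s; split=> //; first by rewrite addn0 in sn.
  by rewrite -setD_eq0 -cards_eq0 -leqn0.
have [V0|[v]] := set_0Vmem (V :\: burned p s).
  exists s; split=> //; first exact: leq_trans (leq_addr _ _) sn.
  by rewrite -setD_eq0 V0.
rewrite in_setD => /andP[vs vV]; apply: (IHn (rcons s v)).
- exact: legal_rcons.
(* Burned vertices stay burned, and [v] leaves the unburned part. *)
- rewrite -ltnS; apply: leq_trans Vn; apply: proper_card.
  rewrite properE burned_rcons setDS/=; last first.
    exact: subset_trans (subsetUl _ _) (subsetUr _ _).
  by apply/subsetPn; exists v; rewrite !inE ?vs ?eqxx.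
- by rewrite size_rcons addSnnS.
Qed.

End Threshold.

Theorem theorem2p16 (R : realType) (p : R) (H : hypergraph)
    (hp : 0 < p < 1)
    (hH : forall v : vertex H, ~~ isolated v)
    (V : {set vertex H})
    (hV : forall e : edge H, meets_threshold p V e)
    (hVmin : forall W : {set vertex H},
      (forall e : edge H, meets_threshold p W e) -> (#|V| <= #|W|)%N) :
  (lazy_burning_number p H <= #|V|)%N /\
  (burning_number p H <= #|V| + 1)%N.
Proof.
split.
  by apply: lazy_burning_number_le; exists 1%N; apply: propagate_setT.
have [s [sl sV Vs]] := legal_cover p V.
(* If everything is burned, no legal source remains, and the sequence must stop at [s]. *)
have [sT|[v]] := set_0Vmem (~: burned p s).
  rewrite addn1; apply/leqW/(leq_trans _ sV)/burning_number_le => //.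
  by rewrite -[burned p s]setCK sT setC0.
rewrite in_setC => vs.
(* Propagation from [burned p s], which contains [V], does the work of this round; [v] only supplies
   the mandatory source. *)
apply: leq_trans (burning_number_le (legal_rcons sl vs) _) _.
  rewrite burned_rcons propagate_setT ?setUT// => e.
  exact: meets_threshold_sub Vs (hV e).
by rewrite size_rcons addn1 ltnS.
Qed.
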